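(* Let $m\ge 1$, $0<\rho<1$, and let $S_j(x)=\rho x+d_j$, $j=0,\dots,m$, where $0=d_0<d_1<\dots<d_m=1-\rho$ and $d_j-d_{j-1}\le\rho$ for all $j=1,\dots,m$. Let $p_0,\dots,p_m>0$ with $\sum_{j=0}^m p_j=1$, and let $\mu$ be the self-similar measure associated with $(S_j,p_j)$. Suppose the IFS has the strict overlap property, i.e. $S_j(1)>S_{j+1}(0)$ for each $j=0,\dots,m-1$. If $p_0<p_j$ for all $j\neq 0$, then $$\sup_{x\in[0,1],\,x\neq 0}\overline{\dim}_{\mathrm{loc}}\,\mu(x)<\dim_{\mathrm{loc}}\mu(0),$$ and thus $\dim_{\mathrm{loc}}\mu(0)$ is an isolated point in the set $\{\dim_{\mathrm{loc}}\mu(x):x\in\operatorname{supp}\mu\}$.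
   Context: The self-similar measure associated with $(S_j,p_j)$ is the unique Borel probability measure $\mu$ satisfying $\mu=\sum_{j=0}^m p_j\cdot\mu\circ S_j^{-1}$. Under the stated assumptions its support is $[0,1]$. For $x\in\operatorname{supp}\mu$, the local dimension is $\dim_{\mathrm{loc}}\mu(x)=\lim_{\epsilon\to0^+}\frac{\log\mu([x-\epsilon,x+\epsilon])}{\log\epsilon}$ when the limit exists, and the upper local dimension is $\overline{\dim}_{\mathrm{loc}}\,\mu(x)=\limsup_{\epsilon\to0^+}\frac{\log\mu([x-\epsilon,x+\epsilon])}{\log\epsilon}$. The set of local dimensions consists of the values $\dim_{\mathrm{loc}}\mu(x)$ over those $x\in\operatorname{supp}\mu$ where the limit exists; the limit at $x=0$ exists as part of the assertion. *)

(* Defs.v *)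
From HB Require Import structures.
From mathcomp Require Import all_boot all_order all_algebra.
From mathcomp Require Import all_classical all_reals all_analysis.

Set Implicit Arguments.
Unset Strict Implicit.
Unset Printing Implicit Defensive.

Import Order.TTheory GRing.Theory Num.Theory.
Import numFieldNormedType.Exports.

Local Open Scope classical_set_scope.
Local Open Scope ring_scope.

Definition ifs_map {R : realType} {m : nat} (rho : R) (d : 'I_m.+1 -> R)
  (j : 'I_m.+1) (x : R) : R := rho * x + d j.

Definition strict_overlap {R : realType} {m : nat} (rho : R)
    (d : 'I_m.+1 -> R) : Prop :=
  forall i j : 'I_m.+1, j = i.+1 :> nat ->
    ifs_map rho d i 1 > ifs_map rho d j 0.

Definition self_similar {R : realType} {m : nat} (S : 'I_m.+1 -> R -> R)
    (p : 'I_m.+1 -> R) (mu : probability (measurableTypeR R) R) : Prop :=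
  forall A : set (measurableTypeR R), measurable A ->
    mu A = (\sum_(j < m.+1) (p j)%:E * mu (S j @^-1` A))%E.

Definition supp {R : realType} (mu : probability (measurableTypeR R) R) :
    set R :=
  [set x | forall U : set R, open U -> U x -> (0 < mu U)%E].

(* For x in supp mu the measure of each ball lies in ]0, 1], so the real
   logarithm is genuine. Values are cast to \bar R so that suprema, limsups and
   infinite limits make sense. *)
Definition loc_quot {R : realType} (mu : probability (measurableTypeR R) R)
    (x : R) (eps : R) : \bar R :=
  (ln (fine (mu `[x - eps, x + eps]%classic)) / ln eps)%:E.

Definition has_local_dim {R : realType}
    (mu : probability (measurableTypeR R) R) (x : R) : Prop :=
  cvg (loc_quot mu x eps @[eps --> 0^'+]).

(* Meaningful only when [has_local_dim mu x] holds. *)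
Definition local_dim {R : realType}
    (mu : probability (measurableTypeR R) R) (x : R) : \bar R :=
  lim (loc_quot mu x eps @[eps --> 0^'+]).

Definition upper_local_dim {R : realType}
    (mu : probability (measurableTypeR R) R) (x : R) : \bar R :=
  limf_esup (loc_quot mu x) 0^'+.

Definition local_dims {R : realType}
    (mu : probability (measurableTypeR R) R) : set (\bar R) :=
  [set local_dim mu x | x in [set x | supp mu x /\ has_local_dim mu x]].

(* Main.v *)
(* Strict overlap lets every x in ]0, 1] be pulled back into ]0, 1] by some
   S_j with either j = 0, so that x becomes x / rho, or S_j^-1(x) >= eta for a
   uniform eta > 0.  By induction on the scale this yields, for b < log p_0 /
   log rho and t = log p_0 / log rho - b small,
     mu [x - r, x + r] >= x^t (rho r)^b:
   a step with j = 0 loses the factor p_0, but x^t grows by rho^-t; the other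
   steps bring x^t back to at worst eta^t, which is paid for by p_j > p_0.
   Hence the upper local dimensions off 0 are at most b.  At 0 only S_0
   contributes at small scales, so the local dimension is log p_0 / log rho. *)

Require Import Defs.
From HB Require Import structures.
From mathcomp Require Import all_boot all_order all_algebra.
From mathcomp Require Import all_classical all_reals all_analysis.
From mathcomp Require Import ring lra.

Import Order.TTheory GRing.Theory Num.Theory.
Import numFieldNormedType.Exports.

Local Open Scope classical_set_scope.
Local Open Scope ring_scope.

(** * Limits superior, logarithmic ratios and real powers *)

Section limits.
Context {R : realType}.

Lemma limf_esup_le_cvg (F : set_system R) (FF : ProperFilter F)
    (f : R -> \bar R) (g : R -> R) (l : R) :
  (\forall e \near F, (f e <= (g e)%:E)%E) -> g e @[e --> F] --> l ->
  (limf_esup f F <= l%:E)%E.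
Proof.
move=> fg gl; apply/lee_addgt0Pr => e e0.
rewrite limf_esupE -EFinD; apply: ge_ereal_inf.
(* The limsup is an infimum over the sets of [F], and this one belongs to [F] because [g] tends to
   [l]. *)
set V := [set x | (f x <= (l + e)%:E)%E].
exists (ereal_sup [set f x | x in V]).
  exists V => //.
  have : \forall x \near F, g x <= l + e.
    by apply: (cvgr_le _ gl); rewrite ltrDl.
  move=> gle; near=> x; apply: (@le_trans _ _ (g x)%:E); first by near: x.
  by rewrite lee_fin; near: x.
by apply/ereal_supP => _ [x xV <-].
Unshelve. all: by end_near. Qed.

Lemma cvg_le_limf_esup (F : set_system R) (FF : ProperFilter F)
    (f : R -> \bar R) (l : \bar R) :
  f e @[e --> F] --> l -> (l <= limf_esup f F)%E.
Proof.
move=> fl; rewrite limf_esupE; apply/ereal_infP => _ [V FV <-].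
apply: (cvge_le _ fl); apply: filterS FV => x Vx.
by apply: ereal_sup_ubound; exists x.
Qed.

(** The ratio is [ln c / ln e + b] and [ln e] tends to minus infinity, so the constant in a power
    bound does not affect the exponent. *)
Lemma cvg_ln_powR_ratio (c b : R) : 0 < c ->
  ln (c * e `^ b) / ln e @[e --> 0^'+] --> b.
Proof.
move=> c0.
have Vln : (ln e)^-1 @[e --> (0:R)^'+] --> (0:R).
  apply/(ltr0_cvgV0 (f := @ln R)); last exact: lnNy.
  near=> e; apply: ln_lt0; apply/andP; split; near: e.
    exact: nbhs_right_gt.
  exact: nbhs_right_lt.
have : ln c * (ln e)^-1 + b @[e --> (0:R)^'+] --> ln c * 0 + b.
  by apply: cvgD; [apply: cvgM => //; exact: cvg_cst|exact: cvg_cst].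
rewrite mulr0 add0r; apply: cvg_trans; apply: near_eq_cvg.
near=> e.
have e0 : 0 < e by near: e; exact: nbhs_right_gt.
have e1 : e < 1 by near: e; exact: nbhs_right_lt.
rewrite lnM ?posrE ?powR_gt0// ln_powR mulrDl mulfK//.
by rewrite lt_eqF// ln_lt0// e0.
Unshelve. all: by end_near. Qed.

Lemma exists_expr_le (rho x : R) : 0 < rho -> rho < 1 -> 0 < x ->
  exists n, rho ^+ n <= x.
Proof.
move=> rho0 rho1 x0.
have h : (fun n => rho ^+ n) @ \oo --> (0 : R).
  by apply: cvg_expr; rewrite gtr0_norm.
have [n _ H] : \forall n \near \oo, rho ^+ n <= x.
  by apply: (cvgr_le _ h).
by exists n; apply: (H n); rewrite /=.
Qed.

Lemma powR_le1 (x s : R) : 0 <= x <= 1 -> 0 <= s -> x `^ s <= 1.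
Proof.
move=> /andP[x0 x1] s0; have <- : 1 `^ s = 1 :> R by rewrite powR1.
by rewrite ge0_ler_powR// nnegrE.
Qed.

Lemma powR_ge1 (x s : R) : 1 <= x -> 0 <= s -> 1 <= x `^ s.
Proof.
move=> x1 s0; have <- : 1 `^ s = 1 :> R by rewrite powR1.
by rewrite ge0_ler_powR// nnegrE (le_trans ler01).
Qed.

End limits.

(** * Local dimensions from power bounds on the mass of balls *)

Section local_dimension.
Context {R : realType} (mu : probability (measurableTypeR R) R).

Definition ball_mass (x r : R) : R := fine (mu `[x - r, x + r]%classic).

Lemma ball_massE x r : (ball_mass x r)%:E = mu `[x - r, x + r]%classic.
Proof. by rewrite /ball_mass fineK// fin_num_measure. Qed.

Lemma ball_mass_ge0 x r : 0 <= ball_mass x r.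
Proof. by rewrite fine_ge0. Qed.

Lemma ball_mass_le1 x r : ball_mass x r <= 1.
Proof. by rewrite -lee_fin ball_massE probability_le1. Qed.

(** Division by [ln e < 0] reverses the order: a lower bound on the mass becomes an upper bound on
    the quotient. *)
Lemma loc_quot_le (x e c b : R) : 0 < c -> 0 < e < 1 ->
  c * e `^ b <= ball_mass x e ->
  (loc_quot mu x e <= (ln (c * e `^ b) / ln e)%:E)%E.
Proof.
move=> c0 /andP[e0 e1] h; rewrite /loc_quot lee_fin.
have h0 : 0 < c * e `^ b by rewrite mulr_gt0// powR_gt0.
rewrite ler_nM2r ?invr_lt0 ?ln_lt0 ?e0//.
by rewrite ler_ln ?posrE//; exact: lt_le_trans h.
Qed.

(** Positivity of the mass is assumed because [ln] takes the default value 0 at 0. *)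
Lemma loc_quot_ge (x e c b : R) : 0 < e < 1 ->
  0 < ball_mass x e -> ball_mass x e <= c * e `^ b ->
  ((ln (c * e `^ b) / ln e)%:E <= loc_quot mu x e)%E.
Proof.
move=> /andP[e0 e1] h0 h; rewrite /loc_quot lee_fin.
rewrite ler_nM2r ?invr_lt0 ?ln_lt0 ?e0//.
by rewrite ler_ln ?posrE//; exact: lt_le_trans h.
Qed.

Lemma upper_local_dim_le (x c b : R) : 0 < c ->
  (\forall e \near 0^'+, c * e `^ b <= ball_mass x e) ->
  (upper_local_dim mu x <= b%:E)%E.
Proof.
move=> c0 h; apply: (limf_esup_le_cvg _ _ _ _ _ _ (cvg_ln_powR_ratio c b c0)).
near=> e; apply: loc_quot_le => //; last by near: e.
by apply/andP; split; near: e; [exact: nbhs_right_gt|exact: nbhs_right_lt].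
Unshelve. all: by end_near. Qed.

Lemma cvg_loc_quot (x c1 c2 b : R) : 0 < c1 -> 0 < c2 ->
  (\forall e \near 0^'+, c1 * e `^ b <= ball_mass x e <= c2 * e `^ b) ->
  loc_quot mu x e @[e --> 0^'+] --> b%:E.
Proof.
move=> c10 c20 h.
apply: (@squeeze_cvge _ _ _ R (fun e => (ln (c2 * e `^ b) / ln e)%:E) _
         (fun e => (ln (c1 * e `^ b) / ln e)%:E)).
- near=> e.
  have e0 : 0 < e by near: e; exact: nbhs_right_gt.
  have e1 : e < 1 by near: e; exact: nbhs_right_lt.
  have /andP[h1 h2] : c1 * e `^ b <= ball_mass x e <= c2 * e `^ b by near: e.
  rewrite loc_quot_ge ?loc_quot_le ?e0//.
  by apply: lt_le_trans h1; rewrite mulr_gt0// powR_gt0.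
- by apply: cvg_EFin; [near=> e|exact: cvg_ln_powR_ratio].
- by apply: cvg_EFin; [near=> e|exact: cvg_ln_powR_ratio].
Unshelve. all: by end_near. Qed.

End local_dimension.

(** * Self-similar measures: concentration on the unit interval and recursion for balls *)

Section self_similar_measure.
Context {R : realType} {m : nat}.
Variables (rho : R) (d p : 'I_m.+1 -> R).
Variable mu : probability (measurableTypeR R) R.
Hypotheses (rho_gt0 : 0 < rho) (rho_lt1 : rho < 1).
Hypotheses (d_first : d ord0 = 0) (d_last : d ord_max = 1 - rho).
Hypothesis d_incr : forall i j : 'I_m.+1, (i < j)%N -> d i < d j.
Hypotheses (p_gt0 : forall j, 0 < p j) (p_sum : \sum_(j < m.+1) p j = 1).
Hypothesis mu_self_similar : self_similar (ifs_map rho d) p mu.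

Local Notation M := (ball_mass mu).

Lemma d_ge0 j : 0 <= d j.
Proof.
have [->|j0] := eqVneq j ord0; first by rewrite d_first.
by rewrite -d_first ltW// d_incr// lt0n.
Qed.

Lemma d_le j : d j <= 1 - rho.
Proof.
have [->|jm] := eqVneq j ord_max; first by rewrite d_last.
rewrite -d_last ltW// d_incr//= ltn_neqAle -ltnS ltn_ord andbT.
by apply: contraNneq jm => jm; apply/eqP/val_inj.
Qed.

Lemma p_le1 j : p j <= 1.
Proof.
rewrite -p_sum (bigD1 j)//= lerDl sumr_ge0// => i _; exact/ltW/p_gt0.
Qed.

(** By self-similarity [mu A] is the average, with weights [p j], of the masses of its preimages,
    each of which contains [B]. *)
Lemma le_measure_preimages (A B : set (measurableTypeR R)) :
  measurable A -> measurable B ->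
  (forall j, measurable (ifs_map rho d j @^-1` A)) ->
  (forall j, B `<=` ifs_map rho d j @^-1` A) -> (mu B <= mu A)%E.
Proof.
move=> mA mB mSA BA; rewrite (mu_self_similar _ mA).
have -> : mu B = (\sum_(j < m.+1) (p j)%:E * mu B)%E.
  rewrite -ge0_sume_distrl; last by move=> j _; rewrite lee_fin ltW.
  by rewrite sumEFin p_sum mul1e.
apply: lee_sum => j _; apply: lee_wpmul2l; first by rewrite lee_fin ltW.
by apply: le_measure; rewrite ?inE; [exact: mB|exact: mSA|exact: BA].
Qed.

Lemma ifs_map_preimage_itv j (a b : R) :
  ifs_map rho d j @^-1` `[a, b]%classic
  = `[(a - d j) / rho, (b - d j) / rho]%classic.
Proof.
apply/seteqP; split => x /=; rewrite !in_itv/= /ifs_map => /andP[h1 h2];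
  apply/andP; split.
- by rewrite ler_pdivrMr// mulrC lerBlDr.
- by rewrite ler_pdivlMr// mulrC lerBrDr.
- by move: h1; rewrite ler_pdivrMr// mulrC lerBlDr.
- by move: h2; rewrite ler_pdivlMr// mulrC lerBrDr.
Qed.

(** As [0 <= d j <= 1 - rho], each map sends the interval with margin [s / rho] into the one with
    margin [s]. Hence enlarging the margin by factors [1 / rho] never increases the mass, although
    these intervals exhaust the line. *)
Lemma measure_neighborhood_unit_itv (s : R) : 0 < s ->
  mu `[- s, 1 + s]%classic = 1%E.
Proof.
move=> s0; apply/eqP; rewrite eq_le probability_le1//=.
pose F n : set R := `[- (s / rho ^+ n), 1 + s / rho ^+ n]%classic.
have leF n : (mu (F n.+1) <= mu (F n))%E.
  apply: le_measure_preimages.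
  - exact: measurable_itv.
  - exact: measurable_itv.
  - by move=> j; rewrite ifs_map_preimage_itv; exact: measurable_itv.
  move=> j; rewrite ifs_map_preimage_itv; apply: subset_itv.
    rewrite bnd_simp exprSr invfM mulrA ler_pdivrMr// mulNr divfK ?gt_eqF//.
    by have := d_ge0 j; lra.
  rewrite bnd_simp exprSr invfM mulrA ler_pdivlMr// mulrDl divfK ?gt_eqF//.
  by have := d_le j; lra.
have leF0 n : (mu (F n) <= mu (F 0%N))%E.
  by elim: n => // n; apply: le_trans; exact: leF.
have F0E : F 0%N = `[- s, 1 + s]%classic by rewrite /F expr0 divr1.
have UF : \bigcup_n F n = setT.
  apply/seteqP; split => // x _.
  have x1 : 0 < 1 + `|x| by rewrite ltr_pwDl.
  have [n hn] := exists_expr_le rho _ rho_gt0 rho_lt1 (divr_gt0 s0 x1).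
  exists n => //; rewrite /F/= in_itv/=.
  have : 1 + `|x| <= s / rho ^+ n.
    by rewrite ler_pdivlMr ?exprn_gt0// mulrC -ler_pdivlMr.
  have := ler_norm x; have := ler_norm (- x); rewrite normrN => ? ? ?.
  by apply/andP; split; lra.
rewrite -F0E -(probability_setT mu) -UF.
apply: cvge_le (nondecreasing_cvg_mu (mu := mu) (F := F) _ _ _).
- by near=> n; exact: leF0.
- by move=> n; exact: measurable_itv.
- by rewrite UF.
- move=> a b ab; rewrite /F; apply/subsetPset/subset_itv; rewrite bnd_simp.
    rewrite lerN2 ler_pM2l// lef_pV2 ?posrE ?exprn_gt0//.
    by rewrite ler_wiXn2l// ?ltW.
  rewrite lerD2l ler_pM2l// lef_pV2 ?posrE ?exprn_gt0//.
  by rewrite ler_wiXn2l// ?ltW.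
Unshelve. all: by end_near. Qed.

(** Continuity from above along the intervals with margins [rho ^+ n], all of mass 1. *)
Lemma measure_unit_itv : mu `[0, 1]%classic = 1%E.
Proof.
pose F n : set R := `[- rho ^+ n, 1 + rho ^+ n]%classic.
have F1 n : mu (F n) = 1%E.
  by apply: measure_neighborhood_unit_itv; rewrite exprn_gt0.
have IF : \bigcap_n F n = `[0, 1]%classic.
  apply/seteqP; split => x /=.
    move=> Fx; rewrite in_itv/=; apply/andP.
    have Fxn n : - rho ^+ n <= x <= 1 + rho ^+ n.
      by have := Fx n I; rewrite /F/= in_itv.
    split; rewrite leNgt; apply/negP => x0.
      have [|n hn] := exists_expr_le rho (- x / 2) rho_gt0 rho_lt1; first lra.
      by have /andP[] := Fxn n; lra.
    have [|n hn] := exists_expr_le rho ((x - 1) / 2) rho_gt0 rho_lt1; first lra.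
    by have /andP[] := Fxn n; lra.
  rewrite in_itv/= => /andP[x0 x1] n _; rewrite /F/= in_itv/=.
  have ? : 0 < rho ^+ n by rewrite exprn_gt0.
  by apply/andP; split; lra.
have h : (mu \o F) x @[x --> \oo] --> mu (\bigcap_n F n).
  apply: nonincreasing_cvg_mu.
  - by rewrite [ltLHS](F1 0%N) ltry.
  - by move=> n; exact: measurable_itv.
  - by rewrite IF; exact: measurable_itv.
  - move=> a b ab; rewrite /F; apply/subsetPset/subset_itv; rewrite bnd_simp.
      by rewrite lerN2 ler_wiXn2l// ?ltW.
    by rewrite lerD2l ler_wiXn2l// ?ltW.
rewrite -IF; apply/eqP; rewrite eq_le probability_le1/=; last first.
  by rewrite IF; exact: measurable_itv.
by apply: cvge_ge h; near=> n; rewrite [leRHS](F1 n).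
Unshelve. all: by end_near. Qed.

Lemma measure_off_unit_itv (A : set (measurableTypeR R)) : measurable A ->
  (forall x, A x -> x \notin `[0, 1]) -> mu A = 0%E.
Proof.
move=> mA hA; apply/eqP; rewrite eq_le measure_ge0 andbT.
have <- : mu (~` `[0, 1]%classic) = 0%E.
  by rewrite probability_setC ?measure_unit_itv ?subee//; exact: measurable_itv.
apply: le_measure; rewrite ?inE//.
  by apply: measurableC; exact: measurable_itv.
by move=> x /hA /negP.
Qed.

Lemma supp_sub_unit_itv : supp mu `<=` `[0, 1]%classic.
Proof.
move=> x sx; apply: contrapT => nx.
have oC : open (~` `[0, 1]%classic : set R).
  by apply: closed_openC; exact: interval_closed.
have := sx _ oC nx; rewrite measure_off_unit_itv ?ltxx//.
  by apply: measurableC; exact: measurable_itv.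
by move=> y /negP.
Qed.

(** The preimage of a ball under an affine map of ratio [rho] is a ball of radius [r / rho] about
    the preimage of the centre. *)
Lemma ball_mass_rec x r :
  M x r = \sum_(j < m.+1) p j * M ((x - d j) / rho) (r / rho).
Proof.
apply/EFin_inj; rewrite ball_massE mu_self_similar; last exact: measurable_itv.
rewrite -sumEFin; apply: eq_bigr => j _; rewrite EFinM ball_massE.
by rewrite ifs_map_preimage_itv -mulrBl -mulrDl (addrAC x (- r)) (addrAC x r).
Qed.

Lemma ball_mass_ge_rec j x r : p j * M ((x - d j) / rho) (r / rho) <= M x r.
Proof.
rewrite [leRHS]ball_mass_rec (bigD1 j)//= lerDl sumr_ge0// => i _.
by rewrite mulr_ge0 ?ball_mass_ge0// ltW.
Qed.

(** Such a ball contains the unit interval; this starts the inductions on the scale. *)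
Lemma ball_mass_eq1 x r : 0 <= x <= 1 -> 1 <= r -> M x r = 1.
Proof.
move=> /andP[x0 x1] r1; apply/eqP; rewrite eq_le ball_mass_le1/=.
rewrite -lee_fin ball_massE -measure_unit_itv.
apply: le_measure; rewrite ?inE; [exact: measurable_itv..|].
by apply: subset_itv; rewrite bnd_simp; lra.
Qed.

Lemma ball_mass_eq0 x r : x + r < 0 -> M x r = 0.
Proof.
move=> xr; apply/EFin_inj; rewrite ball_massE; apply: measure_off_unit_itv.
  exact: measurable_itv.
by move=> y /=; rewrite !in_itv/= => /andP[_ h]; apply/negP => /andP[]; lra.
Qed.

(** * Power bounds for the mass of balls, away from 0 and at 0 *)

Hypothesis overlap : strict_overlap rho d.

Lemma overlap_preimage : exists2 eta, 0 < eta < 1 &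
  forall x, 0 < x <= 1 -> exists j,
    0 < (x - d j) / rho <= 1 /\ (j != ord0 -> eta <= (x - d j) / rho).
Proof.
pose Q (e : R) (ij : 'I_m.+1 * 'I_m.+1) :=
  ij.2 = ij.1.+1 :> nat -> d ij.2 + rho * e <= d ij.1 + rho.
have nearQ ij : \forall e \near (0:R)^'+, Q e ij.
  case: ij => i j; have [ij|/eqP ij] := eqVneq (j : nat) i.+1; last first.
    by near=> e => /ij.
  have := overlap i j ij; rewrite /ifs_map mulr1 mulr0 add0r => dij.
  near=> e => _ /=.
  (* Strict overlap makes this threshold positive; with finitely many pairs of indices, one [e]
     serves them all. *)
  have : e <= (rho + d i - d j) / rho.
    by near: e; apply: nbhs_right_le; rewrite divr_gt0// subr_gt0.
  by rewrite ler_pdivlMr// (mulrC e); lra.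
have [e [e0 e1 He]] : exists e, [/\ 0 < e, e < 1 & forall ij, Q e ij].
  have : \forall e \near (0:R)^'+, [/\ 0 < e, e < 1 & forall ij, Q e ij].
    near=> e; split; near: e.
    - exact: nbhs_right_gt.
    - exact: nbhs_right_lt.
    - exact: filter_forall.
  by move=> /filter_ex[e ?]; exists e.
exists e; first by rewrite e0.
move=> x /andP[x0 x1].
(* The index sought is the largest [j] that is 0 or satisfies [S_j(e) <= x]. *)
pose P (j : 'I_m.+1) := (j == ord0) || (d j + rho * e <= x).
have P0 : P ord0 by rewrite /P eqxx.
have [j Pj jmax] := @arg_maxnP _ ord0 P (@nat_of_ord m.+1) P0.
exists j.
(* If [x > S_j(1)], then [x] also exceeds [S_{j+1}(e)], against maximality; for the last index
   [S_m(1) = 1]. *)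
have xj : x <= d j + rho.
  have [->|jm] := eqVneq j ord_max; first by rewrite d_last; lra.
  have jm' : (j.+1 < m.+1)%N.
    rewrite ltn_neqAle ltn_ord andbT; apply: contraNneq jm => jm.
    by apply/eqP/val_inj => /=; case: jm.
  have := He (j, Ordinal jm') erefl; apply: le_trans.
  rewrite leNgt; apply/negP => h.
  have := jmax (Ordinal jm'); rewrite /P (ltW h) orbT => /(_ isT)/=.
  by rewrite leqNgt ltnSn.
split.
  rewrite ler_pdivrMr// mul1r lerBlDl xj andbT divr_gt0// subr_gt0.
  move: Pj => /orP[/eqP->|]; first by rewrite d_first.
  by apply: lt_le_trans; rewrite ltrDl mulr_gt0.
move=> j0; move: Pj; rewrite /P (negPf j0)/= => h.
by rewrite ler_pdivlMr// lerBrDl mulrC.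
Unshelve. all: by end_near. Qed.

(** Induction on [n] with [rho ^+ n <= r]: passing from [r / rho] to [r] multiplies the power of the
    radius by [rho ^ b], and the two inequalities on [rho ^ b] cover the cases [j = 0] and [j != 0].
    The condition [rho * r <= 1] keeps the left side at most 1, as the starting case requires. *)
Lemma ball_mass_lower (eta t b : R) : 0 <= t -> 0 <= b -> 0 < eta ->
  (forall x, 0 < x <= 1 -> exists j,
    0 < (x - d j) / rho <= 1 /\ (j != ord0 -> eta <= (x - d j) / rho)) ->
  rho `^ b <= p ord0 * rho `^ (- t) ->
  (forall j, j != ord0 -> rho `^ b <= p j * eta `^ t) ->
  forall x r, 0 < x <= 1 -> 0 < r -> rho * r <= 1 ->
  x `^ t * (rho * r) `^ b <= M x r.
Proof.
move=> t0 b0 eta0 pre rho0 rhoj x r x01 r0.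
have [n] := exists_expr_le rho r rho_gt0 rho_lt1 r0.
have big y s : 0 < y <= 1 -> 1 <= s -> rho * s <= 1 ->
    y `^ t * (rho * s) `^ b <= M y s.
  move=> /andP[y0 y1] s1 rs; rewrite ball_mass_eq1 ?(ltW y0)//.
  have h0 : 0 <= rho * s.
    by rewrite mulr_ge0 ?(ltW rho_gt0) ?(le_trans ler01 s1).
  by rewrite mulr_ile1 ?powR_ge0// powR_le1 ?h0 ?rs ?(ltW y0).
elim: n x r x01 r0 => [|n IH] x r x01 r0 hn rr.
  exact: big.
have [r1|r1] := leP 1 r; first exact: big.
have [j [y01 hj]] := pre x x01.
have y0 : 0 < (x - d j) / rho by case/andP: y01.
have /andP[x0 x1] := x01.
apply: le_trans (ball_mass_ge_rec j x r).
have IHr : ((x - d j) / rho) `^ t * r `^ b <= M ((x - d j) / rho) (r / rho).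
  have -> : r = rho * (r / rho) by rewrite mulrC divfK ?gt_eqF.
  rewrite [in M _ _]mulrAC divff ?gt_eqF// mul1r.
  apply: IH => //.
  - by rewrite divr_gt0.
  - by rewrite ler_pdivlMr// -exprSr.
  - by rewrite mulrC divfK ?gt_eqF// ltW.
apply: le_trans (ler_wpM2l (ltW (p_gt0 j)) IHr).
rewrite (powRM b (ltW rho_gt0) (ltW r0)) !mulrA ler_wpM2r ?powR_ge0//.
(* For [j = 0] the preimage is [x / rho], so its power [t] is exactly [rho ^ (- t)] times that of
   [x]. *)
have [j0|j0] := eqVneq j ord0.
  rewrite j0 d_first subr0 powRM ?invr_ge0 ?(ltW x0) ?(ltW rho_gt0)// mulrCA.
  rewrite ler_wpM2l ?powR_ge0//.
  by rewrite -powR_inv1 ?(ltW rho_gt0)// -powRrM mulN1r.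
(* For [j != 0] the factor [x ^ t] is bounded by 1, and the preimage is at least [eta]. *)
apply: (@le_trans _ _ (rho `^ b)).
  by rewrite ler_piMl ?powR_ge0// powR_le1 ?x1 ?(ltW x0).
apply: le_trans (rhoj j j0) _.
rewrite ler_wpM2l ?(ltW (p_gt0 j))//.
by rewrite ge0_ler_powR ?nnegrE ?(ltW eta0) ?(ltW y0) ?hj.
Qed.

(** Since 0 is the fixed point of [S_0], every step can use [j = 0], at the cost of a factor
    [p ord0 = rho ^ a]. *)
Lemma ball_mass0_lower (a : R) : 0 <= a -> rho `^ a = p ord0 ->
  forall r, 0 < r -> rho * r <= 1 -> (rho * r) `^ a <= M 0 r.
Proof.
move=> a0 rhoa r r0; have [n] := exists_expr_le rho r rho_gt0 rho_lt1 r0.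
have big s : 1 <= s -> rho * s <= 1 -> (rho * s) `^ a <= M 0 s.
  move=> s1 rs; rewrite ball_mass_eq1 ?lexx ?ler01//.
  have h0 : 0 <= rho * s.
    by rewrite mulr_ge0 ?(ltW rho_gt0) ?(le_trans ler01 s1).
  by rewrite powR_le1// h0.
elim: n r r0 => [|n IH] r r0 hn rr; first exact: big.
have [r1|r1] := leP 1 r; first exact: big.
apply: le_trans (ball_mass_ge_rec ord0 0 r).
rewrite d_first subr0 mul0r (powRM a (ltW rho_gt0) (ltW r0)) rhoa.
rewrite ler_wpM2l ?(ltW (p_gt0 _))//.
have {1}-> : r = rho * (r / rho) by rewrite mulrC divfK ?gt_eqF.
apply: IH.
- by rewrite divr_gt0.
- by rewrite ler_pdivlMr// -exprSr.
- by rewrite mulrC divfK ?gt_eqF// ltW.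
Qed.

(** For [r < d1] the images of the unit interval under the maps with [j != 0] miss the ball, so the
    recursion reduces to its term [j = 0]. For [r >= d1] the bound is at least 1. *)
Lemma ball_mass0_upper (a d1 : R) : 0 <= a -> rho `^ a = p ord0 -> 0 < d1 ->
  (forall j, j != ord0 -> d1 <= d j) ->
  forall r, 0 < r -> M 0 r <= (r / d1) `^ a.
Proof.
move=> a0 rhoa d10 hd r r0.
have [n] := exists_expr_le rho (r / d1) rho_gt0 rho_lt1 (divr_gt0 r0 d10).
have big s : 1 <= s / d1 -> M 0 s <= (s / d1) `^ a.
  move=> s1; apply: le_trans (ball_mass_le1 _ _ _) _.
  exact: powR_ge1.
elim: n r r0 => [|n IH] r r0 hn; first exact: big.
have [r1|r1] := leP 1 (r / d1); first exact: big.
rewrite ball_mass_rec (bigD1 ord0)//= big1 ?addr0; last first.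
  move=> j j0; rewrite ball_mass_eq0 ?mulr0// sub0r -mulrDl.
  rewrite pmulr_llt0 ?invr_gt0//.
  by have := hd j j0; move: r1; rewrite ltr_pdivrMr// mul1r; lra.
rewrite d_first subr0 mul0r.
have -> : (r / d1) `^ a = p ord0 * (r / rho / d1) `^ a.
  rewrite -rhoa -powRM ?divr_ge0 ?ltW//; congr (_ `^ _).
  by rewrite mulrA [rho * _]mulrC divfK ?gt_eqF.
rewrite ler_wpM2l ?(ltW (p_gt0 _))//; apply: IH.
- by rewrite divr_gt0.
- by rewrite mulrAC ler_pdivlMr// -exprSr.
Qed.

End self_similar_measure.

(** * Choice of the exponents and conclusion *)

Lemma powR_ln_div (R : realType) (x y : R) : 0 < x -> x < 1 -> 0 < y ->
  x `^ (ln y / ln x) = y.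
Proof.
move=> x0 x1 y0; rewrite /powR gt_eqF// divfK ?lnK ?posrE//.
by rewrite lt_eqF// ln_lt0// x0.
Qed.

(** As [t] decreases to 0, [s ^ t] tends to 1, so the finitely many strict inequalities
    [p ord0 < p j] leave room for this factor. *)
Lemma exists_exponent_gap (R : realType) (m : nat) (p : 'I_m.+1 -> R)
    (s a : R) :
  0 < s < 1 -> 0 < a -> (forall j, 0 < p j) ->
  (forall j, j != ord0 -> p ord0 < p j) ->
  exists t, [/\ 0 < t, t < a &
    forall j, j != ord0 -> p ord0 <= p j * s `^ t].
Proof.
move=> /andP[s0 s1] a0 p0 pj.
pose Q (t : R) j := j != ord0 -> p ord0 <= p j * s `^ t.
have nearQ j : \forall t \near (0:R)^'+, Q t j.
  have [->|j0] := eqVneq j ord0; first by near=> t; rewrite /Q eqxx.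
  near=> t => _.
  rewrite -ler_ln ?posrE ?mulr_gt0 ?powR_gt0// lnM ?posrE ?powR_gt0// ln_powR.
  have : t <= (ln (p j) - ln (p ord0)) / - ln s.
    near: t; apply: nbhs_right_le; rewrite divr_gt0 ?oppr_gt0 ?ln_lt0 ?s0//.
    by rewrite subr_gt0 ltr_ln ?posrE ?pj.
  by rewrite ler_pdivlMr ?oppr_gt0 ?ln_lt0 ?s0//; lra.
have : \forall t \near (0:R)^'+, [/\ 0 < t, t < a & forall j, Q t j].
  near=> t; split; near: t.
  - exact: nbhs_right_gt.
  - exact: nbhs_right_lt.
  - exact: filter_forall.
by move=> /filter_ex[t ?]; exists t.
Unshelve. all: by end_near. Qed.

Theorem theorem3p1 (R : realType) (m : nat) (rho : R) (d p : 'I_m.+1 -> R)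
    (mu : probability (measurableTypeR R) R)
    (m_ge1 : (1 <= m)%N)
    (rho_gt0 : 0 < rho) (rho_lt1 : rho < 1)
    (d_first : d ord0 = 0) (d_last : d ord_max = 1 - rho)
    (d_incr : forall i j : 'I_m.+1, (i < j)%N -> d i < d j)
    (d_gap : forall i j : 'I_m.+1, j = i.+1 :> nat -> d j - d i <= rho)
    (p_gt0 : forall j : 'I_m.+1, 0 < p j)
    (p_sum : \sum_(j < m.+1) p j = 1)
    (mu_self_similar : self_similar (ifs_map rho d) p mu)
    (overlap : strict_overlap rho d)
    (p0_min : forall j : 'I_m.+1, j != ord0 -> p ord0 < p j) :
  [/\ has_local_dim mu 0,
      local_dim mu 0 \is a fin_num,
      (ereal_sup [set upper_local_dim mu x | x in `[0%R, 1%R]%classic `\ 0%R]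
         < local_dim mu 0)%E
    & isolated (local_dims mu) (local_dim mu 0)].
Proof.
have max0 : ord_max != ord0 :> 'I_m.+1 by rewrite -lt0n.
have p0_lt1 : p ord0 < 1 := lt_le_trans (p0_min _ max0) (p_le1 p p_gt0 p_sum _).
set a : R := ln (p ord0) / ln rho.
have rhoa : rho `^ a = p ord0 by exact: powR_ln_div.
have a0 : 0 < a.
  by rewrite /a -mulrNN -invrN divr_gt0// oppr_gt0 ln_lt0// ?p_gt0// rho_gt0.
pose d1 := d (Ordinal (m_ge1 : (1 < m.+1)%N)).
have d10 : 0 < d1 by rewrite -d_first d_incr.
have d1_le j : j != ord0 -> d1 <= d j.
  rewrite -lt0n => j0; have [j1|j1] := ltnP 1 j; first by rewrite ltW// d_incr.
  rewrite /d1; have -> // : Ordinal (m_ge1 : (1 < m.+1)%N) = j.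
  by apply/val_inj => /=; apply/eqP; rewrite eqn_leq j0 j1.
(* At 0 the mass lies between two constant multiples of [e ^ a]. *)
have cvg0 : loc_quot mu 0 e @[e --> 0^'+] --> a%:E.
  apply: (cvg_loc_quot mu 0 (rho `^ a) (d1^-1 `^ a)).
  - by rewrite powR_gt0.
  - by rewrite powR_gt0// invr_gt0.
  near=> e.
  have e0 : 0 < e by near: e; exact: nbhs_right_gt.
  have e1 : e <= rho^-1 by near: e; apply: nbhs_right_le; rewrite invr_gt0.
  rewrite -!powRM ?invr_ge0 ?(ltW rho_gt0) ?(ltW e0) ?(ltW d10)//.
  apply/andP; split.
    apply: (ball_mass0_lower rho d p mu) => //; first exact: ltW.
    by rewrite mulrC -ler_pdivlMr// mul1r.
  by rewrite mulrC; apply: (ball_mass0_upper rho d p mu) => //; exact: ltW.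
have dim0 : local_dim mu 0 = a%:E.
  by apply: cvg_lim cvg0; exact: ereal_hausdorff.
have [b ba dimb] : exists2 b, b < a & forall x, 0 < x <= 1 ->
    (upper_local_dim mu x <= b%:E)%E.
  have [eta /andP[eta0 eta1] pre] :=
    overlap_preimage rho d rho_gt0 d_first d_last overlap.
  (* With [b = a - t], [rho ^ b] equals [p ord0 * rho ^ (- t)]; the requirement for [j != 0] then
     reads [p ord0 <= p j * (rho * eta) ^ t], whence the base [rho * eta]. *)
  have rho_eta : 0 < rho * eta < 1.
    by rewrite mulr_gt0//= mulr_ilt1// ltW.
  have [t [t0 ta tp]] := exists_exponent_gap _ _ p _ _ rho_eta a0 p_gt0 p0_min.
  exists (a - t); first by rewrite ltrBlDr ltrDl.
  move=> x /andP[x0 x1].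
  apply: (upper_local_dim_le mu x (x `^ t * rho `^ (a - t))).
    by rewrite mulr_gt0 ?powR_gt0.
  have rhob : rho `^ (a - t) = p ord0 * rho `^ (- t).
    by rewrite powRD ?(gt_eqF rho_gt0) ?implybT// rhoa.
  near=> e.
  have e0 : 0 < e by near: e; exact: nbhs_right_gt.
  have e1 : e <= rho^-1 by near: e; apply: nbhs_right_le; rewrite invr_gt0.
  rewrite -mulrA -powRM ?(ltW rho_gt0) ?(ltW e0)//.
  apply: (ball_mass_lower rho d p mu _ _ _ _ _ _ _ _ eta) => //.
  - exact: ltW.
  - by rewrite subr_ge0 ltW.
  - by rewrite rhob.
  - move=> j j0; rewrite rhob powRN ler_pdivrMr ?powR_gt0// -mulrA.
    by rewrite -powRM ?(ltW eta0) ?(ltW rho_gt0)// (mulrC eta) tp.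
  - by rewrite x0.
  - by rewrite mulrC -ler_pdivlMr// mul1r.
have dim_le x : `[0, 1]%classic x -> x <> 0 -> (upper_local_dim mu x <= b%:E)%E.
  rewrite /= in_itv/= => /andP[x0 x1] /eqP nx0; apply: dimb.
  by rewrite lt_neqAle eq_sym nx0 x0.
have dim0_in : local_dims mu (local_dim mu 0).
  exists 0 => //; split; last by apply/cvg_ex; exists a%:E.
  move=> U oU U0.
  have /nbhs_ballP[e /= e0 eU] : nbhs 0 U by exact: open_nbhs_nbhs.
  (* Small enough for the closed ball to lie in [U] and for the lower bound at 0 to apply. *)
  pose r := Num.min (e / 2) rho^-1.
  have r0 : 0 < r by rewrite lt_min divr_gt0// invr_gt0.
  have re : r <= e / 2 by rewrite ge_min lexx.
  have rr : rho * r <= 1.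
    by rewrite mulrC -ler_pdivlMr// mul1r ge_min lexx orbT.
  apply: (@lt_le_trans _ _ (mu `[0 - r, 0 + r]%classic)).
    rewrite -ball_massE lte_fin.
    apply: (@lt_le_trans _ _ ((rho * r) `^ a)).
      by rewrite powR_gt0// mulr_gt0.
    by apply: (ball_mass0_lower rho d p mu) => //; exact: ltW.
  apply: le_measure; rewrite ?inE; first exact: measurable_itv.
    exact: measurable_realfun.open_measurable.
  move=> y /=; rewrite in_itv/= => /andP[y1 y2]; apply: eU.
  by rewrite /ball/= sub0r normrN ltr_norml; apply/andP; split; lra.
split.
- by apply/cvg_ex; exists a%:E.
- by rewrite dim0.
- rewrite dim0; apply: (@le_lt_trans _ _ b%:E); last by rewrite lte_fin.
  by apply/ereal_supP => _ [x [x01 nx0] <-]; exact: dim_le.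
split.
  exact/mem_set.
(* This neighbourhood isolates the value at 0: at any other point of the support a local dimension,
   being a limit, is at most the upper one, hence at most [b]. *)
exists [set y | (b%:E < y)%E].
  apply: open_nbhs_nbhs; split; first exact: open_ereal_gt_ereal.
  by rewrite /= dim0 lte_fin.
apply/seteqP; split => [y [/= by_ [x [sx hx] xy]]|y /= ->]; last first.
  by split; [rewrite /= dim0 lte_fin|].
have [x0|/eqP nx0] := eqVneq x 0; first by rewrite -xy x0.
have : (y <= b%:E)%E.
  rewrite -xy; apply: le_trans (dim_le x _ nx0); first exact: cvg_le_limf_esup.
  by apply: (supp_sub_unit_itv rho d p mu).
by rewrite leNgt by_.
Unshelve. all: by end_near. Qed.
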